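(* Let $p\in(0,1)$. Assume that there exist positive constants $K_1$ and $K_2$ such that $$\mathbb E\big[(G_{X_1}(X_1))^2\exp\big((G_{X_1}(X_1))^p\big)\big]\le K_1\quad\text{and}\quad\mathbb E\big[(G_\varepsilon(\varepsilon))^2\exp\big((G_\varepsilon(\varepsilon))^p\big)\big]\le K_2.$$ Set $K=K_1+K_2\sum_{i=2}^n\Big(\frac{K_{n-i}(\rho)}{K_{n-1}(\rho)}\Big)^2$. Then, for any $0\le x<K^{1/(2-p)}$, $$\mathbb P(\pm S_n\ge x)\le\exp\left(-\frac{x^2}{2K(K_{n-1}(\rho))^2}\right)+(K_{n-1}(\rho))^2\Big(\frac{x^2}{K^{1+p}}\Big)^{1/(1-p)}\exp\left(-\Big(\frac{K}{x(K_{n-1}(\rho))^{1-p}}\Big)^{p/(1-p)}\right)$$ (the second term being $0$ when $x=0$), and, for any $x\ge K^{1/(2-p)}$, $$\mathbb P(\pm S_n\ge x)\le\exp\left(-\Big(\frac{x}{K_{n-1}(\rho)}\Big)^p\Big(1-\frac K2\Big(\frac{K_{n-1}(\rho)}{x}\Big)^{2-p}\Big)\right)+K\Big(\frac{K_{n-1}(\rho)}{x}\Big)^2\exp\left(-\Big(\frac{x}{K_{n-1}(\rho)}\Big)^p\right).$$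
   Context: $(\mathcal X,d)$ and $(\mathcal Y,\delta)$ are complete separable metric spaces; $(\varepsilon_i)_{i\ge1}$ is a sequence of iid $\mathcal Y$-valued random variables; $X_1$ is an $\mathcal X$-valued random variable independent of $(\varepsilon_i)_{i\ge2}$. The Markov chain is $X_n=F(X_{n-1},\varepsilon_n)$ for $n\ge2$, where $F:\mathcal X\times\mathcal Y\to\mathcal X$ is measurable and satisfies, for some $\rho\in[0,1)$ and $C>0$, $\mathbb E[d(F(x,\varepsilon_1),F(x',\varepsilon_1))]\le\rho\,d(x,x')$ for all $x,x'\in\mathcal X$, and $d(F(x,y),F(x,y'))\le C\,\delta(y,y')$ for all $x\in\mathcal X$, $y,y'\in\mathcal Y$. Fix $n\ge1$ and $f:\mathcal X^n\to\mathbb R$ with $|f(x_1,\ldots,x_n)-f(x_1',\ldots,x_n')|\le d(x_1,x_1')+\cdots+d(x_n,x_n')$, and let $S_n=f(X_1,\ldots,X_n)-\mathbb E[f(X_1,\ldots,X_n)]$. Let $P_{X_1}$ be the law of $X_1$, $P_\varepsilon$ the common law of the $\varepsilon_k$'s, $G_{X_1}(x)=\int d(x,x')P_{X_1}(dx')$, $G_\varepsilon(y)=\int C\,\delta(y,y')P_\varepsilon(dy')$; $G_\varepsilon(\varepsilon)$ denotes a random variable distributed as $G_\varepsilon(\varepsilon_k)$. For $k\in\mathbb N$, $K_k(\rho)=1+\rho+\cdots+\rho^k$ (these are distinct from the constants $K_1,K_2,K$ of the claim). Statements with $\pm$ hold for each of the two signs. *)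

(* Defs.v *)
From HB Require Import structures.
From mathcomp Require Import all_boot all_order all_algebra.
From mathcomp Require Import all_classical all_reals all_analysis.

Set Implicit Arguments.
Unset Strict Implicit.
Unset Printing Implicit Defensive.

Import Order.TTheory GRing.Theory Num.Theory.
Import numFieldNormedType.Exports.

Local Open Scope classical_set_scope.
Local Open Scope ring_scope.

(* [Complete] is pointed in the library; this is no restriction for spaces in
   which a random variable takes its values. *)
#[short(type="completeMetricType")]
HB.structure Definition CompleteMetric (R : numDomainType) :=
  {T of Metric R T & Complete T}.

Definition separable (T : topologicalType) : Prop :=
  exists2 D : set T, countable D & dense D.

Notation borel T := (g_sigma_algebraType (@open T)).

Section independence.
Context {d d' : measure_display} {Omega : measurableType d}
  {T : measurableType d'} {R : realType}.
Variable P : probability Omega R.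

Definition generated_sigma (I : Type) (D : set I)
    (Z : I -> {RV P >-> T}) : set (set Omega) :=
  <<s \bigcup_(i in D) preimage_set_system setT (Z i) measurable >>.

Definition independent_families (A B : set (set Omega)) : Prop :=
  forall E F : set Omega, A E -> B F -> P (E `&` F) = (P E * P F)%E.

Definition mutually_independent (I : eqType) (D : set I)
    (Z : I -> {RV P >-> T}) : Prop :=
  forall (J : seq I) (B : I -> set T), uniq J -> [set` J] `<=` D ->
    (forall i, i \in J -> measurable (B i)) ->
    P (\bigcap_(i in [set` J]) (Z i @^-1` B i)) =
    (\prod_(i <- J) P (Z i @^-1` B i))%E.

(* Two laws are compared on measurable sets only: outside of them the values
   of [P] are irrelevant. *)
Definition identically_distributed (I : Type) (D : set I)
    (Z : I -> {RV P >-> T}) : Prop :=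
  forall i j, D i -> D j -> forall B : set T, measurable B ->
    distribution P (Z i) B = distribution P (Z j) B.

Definition iid (I : eqType) (D : set I) (Z : I -> {RV P >-> T}) : Prop :=
  mutually_independent D Z /\ identically_distributed D Z.

End independence.

Section semi_exponential.
Context {R : realType}.

Definition G_init (X : completeMetricType R)
    (mu : {measure set (borel X) -> \bar R}) (x : X) : \bar R :=
  (\int[mu]_x' (mdist x (x' : X))%:E)%E.

Definition G_noise (Y : completeMetricType R) (C : R)
    (mu : {measure set (borel Y) -> \bar R}) (y : Y) : \bar R :=
  (\int[mu]_y' (C * mdist y (y' : Y))%:E)%E.

(* E[g^2 exp(g^p)], computed in [\bar R] since [G_init] and [G_noise] may a
   priori be infinite. *)
Definition semi_exp_moment (d : measure_display) (Omega : measurableType d)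
    (P : probability Omega R) (p : R) (g : Omega -> \bar R) : \bar R :=
  (\int[P]_w (g w ^+ 2 * expeR (poweR (g w) p)))%E.

Definition geomK (k : nat) (rho : R) : R := \sum_(i < k.+1) rho ^+ i.

Definition path_tuple (Omega T : Type) (X : nat -> Omega -> T) (n : nat)
    (w : Omega) : n.-tuple T := [tuple X i.+1 w | i < n].

Definition centered (d : measure_display) (Omega : measurableType d)
    (P : probability Omega R) (Z : Omega -> R) (w : Omega) : R :=
  Z w - fine ('E_P[Z])%E.

End semi_exponential.

(* Main.v *)
From HB Require Import structures.
Require Import Defs.
From mathcomp Require Import all_boot all_order all_algebra.
From mathcomp Require Import all_classical all_reals all_analysis.
From mathcomp Require Import measurable_realfun.
From mathcomp Require Import ring lra.

Set Implicit Arguments.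
Unset Strict Implicit.
Unset Printing Implicit Defensive.

Import Order.TTheory GRing.Theory Num.Theory.
Import numFieldNormedType.Exports.

Local Open Scope classical_set_scope.
Local Open Scope ring_scope.

(** The deviation [S] is a sum of martingale increments. Conditioning [f] on the
    first [k] states gives functions which are Lipschitz in the path: averaging
    over the next noise turns a weight [c] on the last state into a weight
    [l + c * rho] on the previous one, because [F] contracts in mean. Starting
    from the weight [l] on the last state this produces the geometric sums
    [l * K_(n-i)(rho)], and since [F] is Lipschitz in the noise, the [i]-th
    increment is at most [l * K_(n-i)(rho)] times the potential [G] of the
    [i]-th noise ([lip_noise_center]). After scaling by [l = 1 / L] all weights
    are at most one, so the squared increment times the exponential of its
    [p]-th power has conditional mean at most [a_i^2 * K_2] (resp. [K_1]).

    Such increments may lack exponential moments, so they are truncated at a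
    level [z]. If [t * z^(1-p) <= 1], then [t * u <= u^p] for [0 <= u <= z], and
    a second order Taylor bound gives
      [exp (t * trunc u) <= 1 + t * u + t^2 / 2 * u^2 * exp (|u|^p)]
    ([expR_truncate_le]), where the linear term has conditional mean zero.
    Multiplying along the chain, the truncated sum [W] satisfies
    [E exp (t W) <= exp (t^2 K / 2)], while some increment exceeds [z] with
    probability at most [K * z^-2 * exp (- z^p)]. Chernoff's bound yields
      [P (S / L >= y) <= exp (- t y + t^2 K / 2) + K * z^-2 * exp (- z^p)].
    For large [y] one takes [z = y], [t = y^(p-1)]; for small [y] one takes
    [t = y / K] and [z] with [t * z^(1-p) = 1].

    Conditioning takes place on the sample space: the past before a given time
    is a sigma-algebra there, the next noise is independent of it by a
    pi-lambda argument ([past_indep]), and Tonelli's theorem integrates that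
    noise out ([indep_fubini]). Separability makes all the Lipschitz functions
    of the path measurable ([measurable_lipschitz]). *)

(** * Scalar inequalities *)

Definition truncate {R : realType} (z u : R) : R := if u <= z then u else 0.

Section scalar_bounds.
Context {R : realType}.

Lemma ge0_is_derive_le (f f' : R -> R) (a b : R) : a <= b ->
  (forall x, is_derive x (1 : R) f (f' x)) ->
  (forall x, a <= x <= b -> 0 <= f' x) -> f a <= f b.
Proof.
move=> ab df f'0; rewrite -subr_ge0.
have [|c] := @MVT_segment R f f' a b ab (fun x _ => df x).
  apply: continuous_subspaceT => x.
  by apply/differentiable_continuous/derivable1_diffP; case: (df x).
rewrite in_itv /= => cab ->.
by rewrite mulr_ge0 ?subr_ge0// f'0.
Qed.

(** Second order Taylor bound for the exponential, with a remainder that does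
    not see the negative values of the argument. *)
Lemma expR_le_taylor2 (v : R) :
  expR v <= 1 + v + v ^+ 2 / 2 * expR (Num.max 0 v).
Proof.
have [v0|v0] := leP v 0.
  rewrite expR0 mulr1.
  (* On the negative side, compare the derivative [expR x - 1 - x] with zero. *)
  pose f (x : R) := expR x - 1 - x - x ^+ 2 / 2.
  pose f' (x : R) := expR x - 1 - x.
  have := @ge0_is_derive_le f f' v 0 v0.
  suff df x : is_derive x (1 : R) f (f' x).
    move=> /(_ df); have -> : f 0 = 0 by rewrite /f expR0; ring.
    have f0 x : v <= x <= 0 -> 0 <= f' x.
      by move=> _; rewrite /f'; have := expR_ge1Dx x; lra.
    by move=> /(_ f0); rewrite /f; lra.
  rewrite /f /f'; apply: is_derive_eq; rewrite /GRing.scale /=; field => //.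
(* On the positive side, divide by [expR v] first: the derivative of the
   quotient is [x * (1 - expR (- x))]. *)
pose f (x : R) := (1 + x) * expR (- x) + x ^+ 2 / 2.
pose f' (x : R) := x * (1 - expR (- x)).
have := @ge0_is_derive_le f f' 0 v (ltW v0).
suff df x : is_derive x (1 : R) f (f' x).
  move=> /(_ df); have -> : f 0 = 1 by rewrite /f oppr0 expR0; ring.
  have f0 x : 0 <= x <= v -> 0 <= f' x.
    by move=> /andP[x0 _]; rewrite /f' mulr_ge0 ?subr_ge0 ?expR_le1 ?oppr_le0.
  move=> /(_ f0) /(ler_wpM2l (expR_ge0 v)).
  rewrite /f mulrDr mulrCA expRN divff ?expR_eq0// ?mulr1.
  by rewrite [expR v * (_ / _)]mulrC.
rewrite /f /f'; apply: is_derive_eq; rewrite /GRing.scale /=; field => //.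
Qed.

(** For [0 < u <= z] the exponent is dominated by [u^p], since
    [t u = t u^(1-p) u^p <= t z^(1-p) u^p]; for [u <= 0] the remainder of
    [expR_le_taylor2] has no exponential factor; for [z < u] the left-hand side
    is one and the right-hand side is larger. *)
Lemma expR_truncate_le (p t z u : R) : 0 < p -> p < 1 -> 0 < t -> 0 < z ->
  t * z `^ (1 - p) <= 1 ->
  expR (t * truncate z u) <=
  1 + t * u + t ^+ 2 / 2 * (u ^+ 2 * expR (`|u| `^ p)).
Proof.
move=> p0 p1 t0 z0 tz.
have rem0 : 0 <= t ^+ 2 / 2 * (u ^+ 2 * expR (`|u| `^ p)).
  by apply: mulr_ge0; [rewrite divr_ge0 ?sqr_ge0|rewrite mulr_ge0 ?sqr_ge0 ?expR_ge0].
rewrite /truncate; have [uz|zu] := leP u z; last first.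
  rewrite mulr0 expR0 -addrA lerDl addr_ge0// mulr_ge0 ?ltW//.
  exact: lt_trans zu.
apply: (le_trans (expR_le_taylor2 _)); rewrite lerD2l exprMn.
rewrite [leLHS](_ : _ = t ^+ 2 / 2 * (u ^+ 2 * expR (Num.max 0 (t * u)))); last by ring.
rewrite ler_wpM2l ?divr_ge0 ?sqr_ge0// ler_wpM2l ?sqr_ge0// ler_expR ge_max powR_ge0/=.
have [u0|u0] := leP u 0.
  by rewrite (le_trans _ (powR_ge0 _ _))// pmulr_rle0.
rewrite gtr0_norm//.
have -> : t * u = t * u `^ (1 - p) * u `^ p.
  by rewrite -mulrA -powRD ?subrK ?powRr1 ?ltW// oner_eq0.
rewrite ler_piMl ?powR_ge0//; apply: le_trans tz.
rewrite ler_wpM2l ?(ltW t0)// ge0_ler_powR ?nnegrE ?(ltW u0) ?(ltW z0)//.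
by rewrite subr_ge0 ltW.
Qed.

(** A weight [a <= 1] can be pulled out with its square, which is the factor
    that appears in the variance [K]; the exponential only uses [a g <= g]. *)
Lemma sqr_expR_powR_le (p a u g : R) : 0 < p -> 0 <= a <= 1 -> `|u| <= a * g ->
  u ^+ 2 * expR (`|u| `^ p) <= a ^+ 2 * (g ^+ 2 * expR (g `^ p)).
Proof.
move=> p0 /andP[a0 a1] ug.
have [g0|g0] := leP 0 g; last first.
  have u0 : `|u| = 0.
    by apply/le_anti; rewrite normr_ge0 (le_trans ug)// mulr_ge0_le0// ltW.
  move/normr0_eq0: u0 => ->; rewrite expr0n mul0r.
  by rewrite mulr_ge0 ?sqr_ge0// mulr_ge0 ?sqr_ge0 ?expR_ge0.
rewrite [leRHS]mulrA -exprMn ler_pM ?sqr_ge0 ?expR_ge0//.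
  by rewrite -real_normK ?num_real// lerXn2r ?nnegrE// mulr_ge0.
rewrite ler_expR ge0_ler_powR ?nnegrE ?(ltW p0)//.
by rewrite (le_trans ug)// ler_piMl.
Qed.

(** This makes the potential of the noise integrable once its semi-exponential
    moment is finite. *)
Lemma le_1D_sqr_expR_powR (p y : R) : y <= 1 + y ^+ 2 * expR (y `^ p).
Proof.
have e1 : 0 <= expR (y `^ p) - 1 by rewrite subr_ge0 -expR0 ler_expR powR_ge0.
by have := mulr_ge0 (sqr_ge0 y) e1; have := sqr_ge0 (y - 1); nra.
Qed.

End scalar_bounds.

(** * Choice of the truncation level and of the Chernoff parameter *)

Section parameters.
Context {R : realType} (p : R) (p_gt0 : 0 < p) (p_lt1 : p < 1).

Let q_gt0 : 0 < 1 - p. Proof. by rewrite subr_gt0. Qed.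

(** The truncation level is the deviation [y = x / L] itself, and
    [t = y^(p-1)] is the largest parameter allowed by [t * y^(1-p) <= 1]. *)
Lemma large_deviation_parameters (K L x : R) : 0 < L -> 0 < x ->
  let y := x / L in let t := y `^ (p - 1) in
  [/\ 0 < t, t * y `^ (1 - p) <= 1 &
    expR (- (t * y) + t ^+ 2 / 2 * K) + K * (y ^- 2 * expR (- (y `^ p))) =
    expR (- ((x / L) `^ p * (1 - K / 2 * (L / x) `^ (2 - p)))) +
      K * (L / x) ^+ 2 * expR (- ((x / L) `^ p))].
Proof.
move=> L0 x0 y t.
have y0 : 0 < y by rewrite divr_gt0.
have yn0 : y != 0 by rewrite gt_eqF.
have yV : L / x = y^-1 by rewrite /y invf_div.
have ty : t * y = y `^ p.
  by rewrite -[X in _ * X](powRr1 (ltW y0)) -powRD ?yn0 ?implybT// subrK.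
have t2 : t ^+ 2 = y `^ p * (y^-1) `^ (2 - p).
  rewrite -powR_inv1 ?ltW// -powRrM -powRD ?yn0 ?implybT//.
  rewrite -powR_mulrn ?powR_ge0// -powRrM; congr (_ `^ _); ring.
split.
- exact: powR_gt0.
- by rewrite /t -powRD ?yn0 ?implybT// addrA subrK subrr powRr0.
- rewrite ty t2 yV -/y exprVn mulrA; congr (expR _ + _); ring.
Qed.

(** Here [t = y / K] minimises [- t y + t^2 K / 2], and [z] is the largest
    level allowed by [t * z^(1-p) <= 1]. The second term comes out as
    [(x^2 / K^(1+p))^(1/(1-p)) * L^(-2/(1-p)) * exp (- (K L / x)^(p/(1-p)))],
    and [1 <= L] bounds it by the stated one. *)
Lemma small_deviation_parameters (K L x : R) : 0 < K -> 1 <= L -> 0 < x ->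
  let y := x / L in let t := y / K in let z := (K / y) `^ (1 - p)^-1 in
  [/\ 0 < t, 0 < z, t * z `^ (1 - p) <= 1 &
    expR (- (t * y) + t ^+ 2 / 2 * K) + K * (z ^- 2 * expR (- (z `^ p))) <=
    expR (- (x ^+ 2 / (2 * K * L ^+ 2))) +
      L ^+ 2 * (x ^+ 2 / K `^ (1 + p)) `^ (1 - p)^-1 *
      expR (- ((K / (x * L `^ (1 - p))) `^ (p / (1 - p))))].
Proof.
move=> K0 L1 x0 y t z.
have L0 : 0 < L by exact: lt_le_trans L1.
have y0 : 0 < y by rewrite divr_gt0.
have t0 : 0 < t by rewrite divr_gt0.
have Ky0 : 0 < K / y by rewrite divr_gt0.
have z0 : 0 < z by exact: powR_gt0.
have zq : z `^ (1 - p) = K / y.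
  by rewrite -powRrM mulVf ?powRr1 ?(ltW Ky0)// gt_eqF.
split => //.
  by rewrite zq /t mulrA divfK ?divff ?gt_eqF.
apply: lerD.
  rewrite ler_expR le_eqVlt; apply/orP; left; apply/eqP.
  rewrite /t /y; field.
  by rewrite !gt_eqF.
rewrite mulrA; apply: ler_pM; rewrite ?expR_ge0//.
- by rewrite mulr_ge0 ?(ltW K0)// invr_ge0 sqr_ge0.
- have -> : K * z ^- 2 = (K `^ (1 - p) * (y / K) ^+ 2) `^ (1 - p)^-1.
    rewrite [RHS]powRM ?powR_ge0 ?sqr_ge0// -[in RHS]powRrM mulfV
      ?powRr1 ?(ltW K0) ?gt_eqF//.
    congr (_ * _); rewrite -[y / K]invf_div /z; move: (K / y) Ky0 => u u0.
    rewrite -powR_invn ?powR_ge0// -powRrM -(powR_inv1 (ltW u0)).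
    by rewrite -powR_mulrn ?powR_ge0// -!powRrM; congr (_ `^ _); ring.
  apply: (@le_trans _ _ (1 * (x ^+ 2 / K `^ (1 + p)) `^ (1 - p)^-1)); last first.
    by rewrite ler_wpM2r ?powR_ge0// exprn_ege1.
  rewrite mul1r ge0_ler_powR ?nnegrE ?invr_ge0 ?(ltW q_gt0)//.
  + by rewrite mulr_ge0 ?powR_ge0 ?sqr_ge0.
  + by rewrite divr_ge0 ?powR_ge0 ?sqr_ge0.
  + have K2 : K `^ (1 - p) * K `^ (1 + p) = K ^+ 2.
      rewrite -powRD ?(gt_eqF K0) ?implybT// -powR_mulrn ?(ltW K0)//.
      by congr (_ `^ _); ring.
    rewrite ler_pdivlMr ?powR_gt0// mulrAC K2 expr_div_n mulrCA divff ?mulr1.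
      by rewrite lerXn2r ?nnegrE ?(ltW x0) ?(ltW y0)// ler_pdivrMr// ler_peMr// ltW.
    by rewrite expf_neq0// gt_eqF.
- rewrite ler_expR lerN2 /z -powRrM [_^-1 * p]mulrC.
  rewrite ge0_ler_powR ?nnegrE ?(ltW Ky0)//.
  + by rewrite divr_ge0 ?ltW.
  + by rewrite divr_ge0 ?mulr_ge0 ?powR_ge0 ?ltW.
  rewrite ler_pM2l// lef_pV2 ?posrE ?y0 ?mulr_gt0 ?powR_gt0//.
  rewrite /y ler_pM2l// (@le_trans _ _ 1)// ?invf_le1//.
  have := @ge0_ler_powR _ (1 - p) (ltW q_gt0) 1 L.
  by rewrite !nnegrE ler01 (ltW L0) powR1; exact.
Qed.

End parameters.

(** * Integrals over independent variables *)

Section measure_bounds.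
Context {R : realType} {d : measure_display} {T : measurableType d}.

Lemma markov_bound (mu : {measure set T -> \bar R}) (A : set T)
    (f : T -> \bar R) (c : R) :
  measurable A -> measurable_fun setT f -> (forall x, 0 <= f x)%E ->
  0 <= c -> (forall x, A x -> c%:E <= f x)%E ->
  (c%:E * mu A <= \int[mu]_x f x)%E.
Proof.
move=> mA mf f0 c0 Af; rewrite -integral_cst//.
apply: (@le_trans _ _ (\int[mu]_(x in A) f x)%E).
  apply: ge0_le_integral => //.
  exact: measurable_funTS.
exact: ge0_subset_integral.
Qed.

Lemma integrable_distribution {d'} {T' : measurableType d'}
    (P : probability T R) (Z : {RV P >-> T'}) (f : T' -> \bar R) :
  (distribution P Z).-integrable setT f -> P.-integrable setT (f \o Z).
Proof.
move=> /integrableP[mf foo]; apply/integrableP; split.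
  exact: measurableT_comp.
rewrite (_ : integral _ _ _ = (\int[distribution P Z]_y `|f y|)%E)//.
rewrite ge0_integral_distribution//.
exact: measurableT_comp.
Qed.

Lemma measurable_truncate (z : R) : measurable_fun setT (truncate z).
Proof. by apply: measurable_fun_if => //; exact: measurable_fun_ler. Qed.

End measure_bounds.

(** Independence of [V] and [e], where [e] has law [nu], is used in the form
    that the joint law of [V] and [e] is a product measure. *)
Section independent_fubini.
Context {R : realType} {d d1 d2 : measure_display} {Omega : measurableType d}.
Context {T : measurableType d1} {Y : measurableType d2}.
Context (P : probability Omega R) (V : Omega -> T) (e : Omega -> Y).
Context (nu : probability Y R).
Context (mV : measurable_fun setT V) (me : measurable_fun setT e).
Context (indep : forall A B, measurable A -> measurable B ->
  (P (V @^-1` A `&` e @^-1` B) = P (V @^-1` A) * nu B)%E).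

Let mVe : measurable_fun setT (fun w => (V w, e w)).
Proof. exact: measurable_fun_pair. Qed.

Let Ve : {RV P >-> (T * Y)%type} :=
  HB.pack (fun w => (V w, e w)) (isMeasurableFun.Build _ _ _ _ _ mVe).

Let Vr : {RV P >-> T} := HB.pack V (isMeasurableFun.Build _ _ _ _ _ mV).

Lemma indep_fubini (f : T * Y -> \bar R) : measurable_fun setT f ->
  (forall x, 0 <= f x)%E ->
  (\int[P]_w f (V w, e w) = \int[P]_w \int[nu]_y f (V w, y))%E.
Proof.
move=> mf f0.
rewrite -(ge0_integral_distribution Ve mf f0).
have FT := @fubini_tonelli1 _ _ _ _ _ (distribution P Vr) nu f mf f0.
apply: (etrans _ (etrans FT _)).
  apply: eq_measure_integral => A mA _; apply/esym.
  exact: product_measure_unique.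
rewrite ge0_integral_distribution//.
- exact: measurable_fun_fubini_tonelli_F.
- by move=> x; apply: integral_ge0 => y _.
Qed.

Lemma indep_fubini_le (f : T * Y -> \bar R) (b : T -> \bar R) :
  measurable_fun setT f -> (forall x, 0 <= f x)%E -> measurable_fun setT b ->
  (forall x, \int[nu]_y f (x, y) <= b x)%E ->
  (\int[P]_w f (V w, e w) <= \int[P]_w b (V w))%E.
Proof.
move=> mf f0 mb fb; rewrite indep_fubini//; apply: ge0_le_integral => //.
- by move=> w _; exact: integral_ge0.
- have mI : measurable_fun setT (fubini_F nu f).
    exact: measurable_fun_fubini_tonelli_F.
  exact: (measurableT_comp mI mV).
- exact: (measurableT_comp mb mV).
Qed.

(** The positive and the negative part have the same integral over the second
    variable for each value of the first, hence the same expectation. *)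
Lemma indep_mean0 (f : T * Y -> R) : measurable_fun setT f ->
  P.-integrable setT (fun w => (f (V w, e w))%:E) ->
  (forall x, nu.-integrable setT (fun y => (f (x, y))%:E)) ->
  (forall x, \int[nu]_y (f (x, y))%:E = 0)%E ->
  (\int[P]_w (f (V w, e w))%:E = 0)%E.
Proof.
move=> mf iP inu f0.
have mEf : measurable_fun setT (EFin \o f) by exact/measurable_EFinP.
have mp := measurable_funepos mEf.
have mn := measurable_funeneg mEf.
have eqpn : (\int[P]_w (EFin \o f)^\+ (V w, e w) =
             \int[P]_w (EFin \o f)^\- (V w, e w))%E.
  rewrite (indep_fubini mp)// (indep_fubini mn)//.
  apply: eq_integral => w _; have := f0 (V w); rewrite integralE.
  have fp := integrable_pos_fin_num measurableT (inu (V w)).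
  have fn := integrable_neg_fin_num measurableT (inu (V w)).
  move/eqP; rewrite sube_eq ?add0e ?fin_num_adde_defr// => /eqP.
  under eq_integral do rewrite funeposE.
  under [in X in _ = X]eq_integral do rewrite funenegE.
  under [in X in _ -> X]eq_integral do rewrite funeposE.
  by under [in X in _ -> _ = X]eq_integral do rewrite funenegE.
rewrite integralE.
have fn := integrable_neg_fin_num measurableT iP.
apply/eqP; rewrite sube_eq ?add0e ?fin_num_adde_defr//.
  apply/eqP; transitivity (\int[P]_w (EFin \o f)^\+ (V w, e w))%E.
    by apply: eq_integral => w _; rewrite !funeposE.
  by rewrite eqpn; apply: eq_integral => w _; rewrite !funenegE.
exact: integrable_pos_fin_num.
Qed.

End independent_fubini.

Section past.
Context {R : realType} {d d1 d2 : measure_display} {Omega : measurableType d}.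
Context {TX : measurableType d1} {TY : measurableType d2}.
Context (P : probability Omega R).
Context (xi : {RV P >-> TX}) (e : nat -> {RV P >-> TY}) (nu : probability TY R).

(** Finite intersections of events of the initial value and of the first [k]
    noises: a pi-system, so that independence of the next noise has to be
    checked on it only. *)
Definition past_cylinders (k : nat) : set (set Omega) :=
  [set E | exists A (B : nat -> set TY), [/\ measurable A,
     forall i, measurable (B i) &
     E = xi @^-1` A `&` \bigcap_(i < k) (e i @^-1` B i)]].

Lemma past_cylinders_measurable k : past_cylinders k `<=` measurable.
Proof.
move=> _ [A [B [mA mB ->]]]; apply: measurableI; first exact: measurable_funPTI.
by apply: bigcap_measurableType => i _; exact: measurable_funPTI.
Qed.

Lemma past_cylinders_setI k : setI_closed (past_cylinders k).
Proof.
move=> _ _ [A [B [mA mB ->]]] [A' [B' [mA' mB' ->]]].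
exists (A `&` A'), (fun i => B i `&` B' i); split.
- exact: measurableI.
- by move=> i; exact: measurableI.
- by rewrite setIACA -bigcapI preimage_setI.
Qed.

Lemma past_cylinders_setT k : past_cylinders k setT.
Proof.
exists setT, (fun=> setT); split => //.
by apply/seteqP; split=> // w _; split.
Qed.

(** The sample space with the sigma-algebra of the initial value and of the
    first [k] noises. *)
Definition past (k : nat) := g_sigma_algebraType (past_cylinders k).

Lemma past_sub k (E : set Omega) : @measurable _ (past k) E -> measurable E.
Proof.
move: E; apply: smallest_sub; last exact: past_cylinders_measurable.
exact: sigma_algebra_measurable.
Qed.

Lemma past_mono k (E : set Omega) :
  @measurable _ (past k) E -> @measurable _ (past k.+1) E.
Proof.
move: E; apply: smallest_sub; first exact: sigma_algebra_measurable.
move=> _ [A [B [mA mB ->]]]; apply: sub_sigma_algebra.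
exists A, (fun i => if (i < k)%N then B i else setT); split => //.
  by move=> i; case: ifP.
congr (_ `&` _); apply/seteqP; split => w H i /= ik.
  by case: ifP => // ik'; exact: H.
by have := H i (ltnW ik); rewrite /= ik.
Qed.

Context (indep : forall k A (B : nat -> set TY), measurable A ->
  (forall i, measurable (B i)) ->
  (P (xi @^-1` A `&` \bigcap_(i < k) (e i @^-1` B i)) =
   P (xi @^-1` A) * \prod_(i < k) nu (B i))%E).

(** For fixed [B], both sides are finite measures in [E], and they agree on the
    pi-system of cylinders. *)
Lemma past_indep k (E : set Omega) (B : set TY) :
  @measurable _ (past k) E -> measurable B ->
  (P (E `&` e k @^-1` B) = P E * nu B)%E.
Proof.
move=> mE mB.
have mF : measurable (e k @^-1` B) by exact: measurable_funPTI.
have nuB0 : 0 <= fine (nu B) by rewrite fine_ge0.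
pose m1 := mrestr P mF.
pose m2 := mscale (NngNum nuB0) P.
have := @g_sigma_algebra_measure_unique _ R Omega (past_cylinders k)
  (@past_cylinders_measurable k) (fun=> setT) (fun=> past_cylinders_setT k).
rewrite bigcup_const//.
have m12 : forall A, past_cylinders k A -> m1 A = m2 A.
  move=> _ [A [C [mA mC ->]]].
  (* The event of the next noise extends the cylinder by one coordinate. *)
  pose C' i := if i == k then B else C i.
  have mC' i : measurable (C' i) by rewrite /C'; case: ifP.
  rewrite /m1 /mrestr /m2 /mscale /= fineK; last exact: fin_num_measure.
  rewrite indep// muleC -muleA.
  have := @indep k.+1 A C' mA mC'.
  rewrite big_ord_recr /= [in X in (_ * X)%E]/C' eqxx.
  under eq_bigr do rewrite /C' ltn_eqF//.
  move=> <-; congr (P _); rewrite -setIA; congr (_ `&` _).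
  rewrite predeqE => w; split.
    move=> [H Bk] i /= ; rewrite ltnS leq_eqVlt /C'.
    by case: eqP => [->|_]//= ik; exact: H.
  move=> H; split; last by have := H k (leqnn _); rewrite /= /C' eqxx.
  by move=> i /= ik; have := H i (ltnW ik); rewrite /= /C' ltn_eqF.
move=> /(_ erefl m1 m2 (@past_cylinders_setI k) m12).
have H (i : nat) : (m1 setT < +oo)%E.
  by rewrite /m1 /mrestr (le_lt_trans (probability_le1 _ _)) ?ltry// setTI.
move=> /(_ H E mE) EE; have {EE} : m1 E = m2 E by [].
rewrite /m1 /mrestr /m2 /mscale /= fineK; last exact: fin_num_measure.
by rewrite muleC.
Qed.

Lemma noise_law k B : measurable B -> P (e k @^-1` B) = nu B.
Proof.
move=> mB.
have := @past_indep k setT B measurableT mB.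
by rewrite setTI probability_setT mul1e.
Qed.

End past.

(** * Measurability of Lipschitz functions *)

Section metric_measurability.
Context {R : realType} (X0 : completeMetricType R).

Lemma open_metric_ball (x : X0) (r : R) : open [set y | mdist x y < r].
Proof.
rewrite openE => y /= xyr; apply/nbhs_ballP; exists (r - mdist x y) => /=.
  by rewrite subr_gt0.
move=> z; rewrite ballEmdist /= ltrBrDl => yz.
exact: le_lt_trans (metric_triangle _ _ _) yz.
Qed.

Lemma measurable_mdist {d} {T : measurableType d} (Z : T -> borel X0) (q : X0) :
  measurable_fun setT Z -> measurable_fun setT (fun t => mdist q (Z t : X0) : R).
Proof.
move=> mZ; apply: (measurability _ (RGenInftyO.measurableE R)).
move=> _ [_ [x ->] <-].
have := mZ measurableT [set y : X0 | mdist q y < x].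
rewrite !setTI => /(_ (@sub_sigma_algebra _ setT open _ (open_metric_ball q x))).
by congr measurable; apply/seteqP; split=> t /=; rewrite in_itv.
Qed.

Lemma separable_seq : separable X0 -> exists e : nat -> X0,
  forall (x : X0) (r : R), 0 < r -> exists n, mdist (e n) x < r.
Proof.
move=> [D /countable_injP[g ginj] dD].
pose e n := xget point [set x | D x /\ g x = n].
exists e => x r r0.
have [||y [/= xy Dy]] := dD [set y | mdist x y < r].
- by exists x; rewrite /= mdistxx.
- exact: open_metric_ball.
exists (g y); rewrite metric_sym /e.
case: xgetP => [z -> [Dz gz]|/(_ y)]; last by case.
by move: gz => /ginj -> //; rewrite inE.
Qed.

(** A Lipschitz function is the infimum of the cones
    [h q + \sum_i c_i d(q_i, .)] over a countable dense family of [q], so its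
    strict sublevel sets are countable unions of sublevel sets of the cones.
    Each cone is a sum of functions of one coordinate, so coordinatewise
    measurability of [Z] suffices. *)
Lemma measurable_lipschitz {d} {T : measurableType d} (k : nat) (c : nat -> R)
    (h : (nat -> X0) -> R) (Z : T -> nat -> X0) :
  separable X0 ->
  (forall x x', `|h x - h x'| <= \sum_(i < k) c i * mdist (x i) (x' i)) ->
  (forall i, (i < k)%N -> measurable_fun setT (fun t => Z t i : borel X0)) ->
  measurable_fun setT (h \o Z).
Proof.
move=> /separable_seq[e eP] hlip mZ.
apply: (measurability _ (RGenInftyO.measurableE R)).
move=> _ [_ [x ->] <-]; rewrite setTI.
(* Finite lists of indices enumerate a dense family of paths, as [h] depends
   on the first [k] coordinates only. *)
pose q (l : seq nat) i := e (nth 0%N l i).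
pose A (l : seq nat) := [set t | h (q l) + \sum_(i < k) c i * mdist (q l i) (Z t i) < x].
have -> : (h \o Z) @^-1` `]-oo, x[%classic = \bigcup_l A l.
  apply/seteqP; split => t /=; rewrite in_itv /=; last first.
    move=> [l _]; apply: le_lt_trans.
    have := hlip (Z t) (q l).
    under eq_bigr do rewrite metric_sym.
    by move=> H; rewrite -lerBlDl (le_trans (ler_norm _)).
  (* Coordinates within [r] change the cone by at most half of the gap, and
     [h] by at most the other half. *)
  move=> hx; pose r := (x - h (Z t)) / (2 * (1 + \sum_(i < k) `|c i|)).
  have s0 : 0 < 1 + \sum_(i < k) `|c i|.
    by rewrite ltr_wpDr// sumr_ge0.
  have r0 : 0 < r by rewrite divr_gt0 ?subr_gt0// mulr_gt0.
  have [n nP] := choice (fun i => eP (Z t i) r r0).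
  pose l := mkseq n k.
  have ql (i : 'I_k) : `|c i * mdist (q l i) (Z t i)| <= `|c i| * r.
    rewrite normrM ler_wpM2l// ger0_norm ?mdist_ge0//.
    by rewrite /q nth_mkseq// ltW.
  exists l => //; rewrite /A /=.
  have S1 : \sum_(i < k) c i * mdist (q l i) (Z t i) <= (\sum_(i < k) `|c i|) * r.
    by rewrite mulr_suml ler_sum// => i _; rewrite (le_trans (ler_norm _)).
  have := hlip (q l) (Z t) => /(le_trans (ler_norm _)) H.
  have S2 : r * (2 * (1 + \sum_(i < k) `|c i|)) = x - h (Z t).
    by rewrite /r divfK// gt_eqF// mulr_gt0.
  nra.
apply: countable_bigcupT_measurable => // l.
have -> : A l = (fun t => h (q l) +
    \sum_(i < k) c i * mdist (q l i) (Z t i)) @^-1` `]-oo, x[.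
  by apply/seteqP; split=> t /=; rewrite in_itv.
rewrite -[X in measurable X]setTI.
have mf : measurable_fun setT
    (fun t => h (q l) + \sum_(i < k) c i * mdist (q l i) (Z t i)).
  apply: measurable_funD => //; apply: measurable_sum => i.
  by apply: measurable_funM => //; apply: measurable_mdist; exact: mZ.
exact: mf.
Qed.

Lemma measurable_lip1 (u : X0 -> R) (c : R) :
  separable X0 -> (forall v v', `|u v - u v'| <= c * mdist v v') ->
  measurable_fun setT (u : borel X0 -> R).
Proof.
move=> sepX ulip.
have := @measurable_lipschitz _ (borel X0) 1 (fun=> c)
  (fun s => u (s 0%N)) (fun v _ => v) sepX.
apply => //; by move=> x x'; rewrite big_ord1.
Qed.

Lemma measurable_mdist2 {d} {T : measurableType d} (U V : T -> borel X0) :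
  separable X0 -> measurable_fun setT U -> measurable_fun setT V ->
  measurable_fun setT (fun t => mdist (U t : X0) (V t : X0)).
Proof.
move=> sepX mU mV.
apply: (@measurable_lipschitz _ T 2 (fun=> 1) (fun s => mdist (s 0%N) (s 1%N))
  (fun t i => if i == 0%N then U t else V t) sepX) => [s s'|i _]; last first.
  by case: eqP.
rewrite big_ord_recr big_ord1 /= !mul1r ler_norml.
have := metric_triangle (s 0%N) (s' 0%N) (s 1%N).
have := metric_triangle (s' 0%N) (s' 1%N) (s 1%N).
have := metric_triangle (s' 0%N) (s 0%N) (s' 1%N).
have := metric_triangle (s 0%N) (s 1%N) (s' 1%N).
rewrite (metric_sym (s' 1%N) (s 1%N)) (metric_sym (s' 0%N) (s 0%N)); lra.
Qed.

End metric_measurability.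

(** * Lipschitz functions of a semi-exponential noise *)

(** The real-valued version of [G_noise], which is finite in the setting below
    ([G_noiseE]). *)
Definition noise_potential {R : realType} {Y0 : completeMetricType R} (C : R)
    (nu : {measure set (borel Y0) -> \bar R}) (v : Y0) : R :=
  fine (G_noise C nu v).

Section semi_exponential_noise.
Context {R : realType} (Y0 : completeMetricType R) (sepY : separable Y0).
Context {d : measure_display} {Omega : measurableType d}.
Context (P : probability Omega R) (Z : {RV P >-> borel Y0}).
Context (C : R) (C_gt0 : 0 < C) (p : R) (p_gt0 : 0 < p) (p_lt1 : p < 1).
Context (M : R).
Context (moment : (semi_exp_moment P p
  (fun w => G_noise C (distribution P Z) (Z w)) <= M%:E)%E).

Local Notation nu := (distribution P Z).

Local Notation g := (noise_potential C nu).

Lemma measurable_dist_noise (v : Y0) :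
  measurable_fun setT (fun y : borel Y0 => C * mdist v (y : Y0)).
Proof. by apply: measurable_funM => //; exact: measurable_mdist. Qed.

Lemma G_noise_ge0 (v : Y0) : (0 <= G_noise C nu v)%E.
Proof.
by apply: integral_ge0 => y _; rewrite lee_fin mulr_ge0 ?mdist_ge0// ltW.
Qed.

Lemma G_noise_triangle (v w : Y0) :
  (G_noise C nu v <= (C * mdist v w)%:E + G_noise C nu w)%E.
Proof.
have -> : ((C * mdist v w)%:E + G_noise C nu w =
    \int[nu]_y ((C * mdist v w)%:E + (C * mdist w (y : Y0))%:E))%E.
  rewrite ge0_integralD//=.
  - by rewrite integral_cst// [X in (_ * X)%E]probability_setT mule1.
  - by move=> y _; rewrite lee_fin mulr_ge0 ?mdist_ge0// ltW.
  - by move=> y _; rewrite lee_fin mulr_ge0 ?mdist_ge0// ltW.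
  - by apply/measurable_EFinP; exact: measurable_dist_noise.
apply: ge0_le_integral => //=.
- by move=> y _; rewrite lee_fin mulr_ge0 ?mdist_ge0// ltW.
- by apply/measurable_EFinP; exact: measurable_dist_noise.
- apply/measurable_EFinP/measurable_funD => //; exact: measurable_dist_noise.
- move=> y _; rewrite -EFinD lee_fin -mulrDr ler_wpM2l ?(ltW C_gt0)//.
  exact: metric_triangle.
Qed.

(** By the triangle inequality the potential is finite at every point as soon
    as it is finite at one; the moment bound excludes that it is infinite
    everywhere. *)
Lemma G_noiseE (v : Y0) : G_noise C nu v = (g v)%:E.
Proof.
rewrite /noise_potential fineK// ge0_fin_numE ?G_noise_ge0// ltey; apply/eqP => Gv.
have Gy w : G_noise C nu w = +oo%E.
  by have := G_noise_triangle v w; rewrite Gv leye_eq; case: (G_noise C nu w).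
move: moment; rewrite /semi_exp_moment.
under eq_integral do rewrite Gy poweRyr ?gt_eqF//=.
by rewrite !mulyy integral_cst// [X in (_ * X)%E]probability_setT mule1 leye_eq.
Qed.

Lemma noise_ge0 (v : Y0) : 0 <= g v.
Proof. by rewrite -lee_fin -G_noiseE G_noise_ge0. Qed.

Lemma noise_lip (v w : Y0) : `|g v - g w| <= C * mdist v w.
Proof.
have H a b : g a <= C * mdist a b + g b.
  by rewrite -lee_fin EFinD -!G_noiseE G_noise_triangle.
by rewrite ler_norml; have := H v w; have := H w v; rewrite metric_sym; lra.
Qed.

Lemma measurable_noise : measurable_fun setT (g : borel Y0 -> R).
Proof. by apply: (measurable_lip1 sepY); exact: noise_lip. Qed.

Lemma measurable_sqr_expR_powR d' (T : measurableType d') (u : T -> R) :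
  measurable_fun setT u ->
  measurable_fun setT (fun v => u v ^+ 2 * expR (u v `^ p)).
Proof.
move=> mu; apply: measurable_funM; first exact: measurable_funX.
apply: measurableT_comp => //.
exact: (measurableT_comp (@measurable_powR R p)).
Qed.

Lemma noise_moment :
  (\int[nu]_v (g v ^+ 2 * expR (g v `^ p))%:E <= M%:E)%E.
Proof.
rewrite ge0_integral_distribution; last 2 first.
- by apply/measurable_EFinP; apply: measurable_sqr_expR_powR; exact: measurable_noise.
- by move=> y; rewrite lee_fin mulr_ge0 ?sqr_ge0 ?expR_ge0.
apply: le_trans moment; rewrite le_eqVlt; apply/orP; left; apply/eqP.
by apply: eq_integral => w _; rewrite G_noiseE poweR_EFin /= EFinM EFin_expe.
Qed.

Lemma noise_moment_integrable :
  nu.-integrable setT (fun v => (g v ^+ 2 * expR (g v `^ p))%:E).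
Proof.
apply/integrableP; split.
  by apply/measurable_EFinP; apply: measurable_sqr_expR_powR; exact: measurable_noise.
rewrite (eq_integral (fun v : borel Y0 => ((g v ^+ 2 * expR (g v `^ p))%:E)%E)).
  by rewrite (le_lt_trans noise_moment)// ltry.
by move=> v _; rewrite /= ger0_norm// mulr_ge0 ?sqr_ge0 ?expR_ge0.
Qed.

Lemma noise_integrable : nu.-integrable setT (EFin \o g).
Proof.
apply: (@le_integrable _ _ _ _ _ _ _
  (cst 1%:E \+ (fun v : borel Y0 => (g v ^+ 2 * expR (g v `^ p))%:E))%E) => //.
- by apply/measurable_EFinP; exact: measurable_noise.
- move=> v _; rewrite -EFinD lee_fin !ger0_norm ?noise_ge0//; last first.
    by rewrite addr_ge0// mulr_ge0 ?sqr_ge0 ?expR_ge0.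
  exact: le_1D_sqr_expR_powR.
apply: integrableD => //; first exact: finite_measure_integrable_cst.
exact: noise_moment_integrable.
Qed.

End semi_exponential_noise.

(** A function of the noise with Lipschitz weight [a <= 1], centered by its mean
    [m]: this is a martingale increment once the past is frozen. *)
Section centered_lipschitz_noise.
Context {R : realType} (Y0 : completeMetricType R) (sepY : separable Y0).
Context {d : measure_display} {Omega : measurableType d}.
Context (P : probability Omega R) (Z : {RV P >-> borel Y0}).
Context (C : R) (C_gt0 : 0 < C) (p : R) (p_gt0 : 0 < p) (p_lt1 : p < 1).
Context (M : R).
Context (moment : (semi_exp_moment P p
  (fun w => G_noise C (distribution P Z) (Z w)) <= M%:E)%E).
Context (a : R) (a01 : 0 <= a <= 1) (u : Y0 -> R).
Context (u_lip : forall v v', `|u v - u v'| <= a * (C * mdist v v')).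

Local Notation nu := (distribution P Z).
Local Notation g := (noise_potential C nu).
Let m : R := \int[nu]_v u v.

Let measurable_u : measurable_fun setT (u : borel Y0 -> R).
Proof.
apply: (@measurable_lip1 _ _ u (a * C) sepY) => // v v'.
by rewrite -mulrA; exact: u_lip.
Qed.

Let dist_integrable (v : Y0) :
  nu.-integrable setT (fun y : borel Y0 => (C * mdist v (y : Y0))%:E).
Proof.
apply/integrableP; split.
  by apply/measurable_EFinP; exact: measurable_dist_noise.
rewrite (eq_integral (fun y : borel Y0 => (C * mdist v (y : Y0))%:E)).
  by rewrite -/(G_noise _ _ _) (G_noiseE C_gt0 p_gt0 moment) ltry.
by move=> y _; rewrite /= ger0_norm// mulr_ge0 ?mdist_ge0 ?(ltW C_gt0).
Qed.

Lemma lip_noise_integrable : nu.-integrable setT (EFin \o u).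
Proof.
pose v0 : Y0 := point.
apply: (@le_integrable _ _ _ _ _ _ _
  (cst (`|u v0|)%:E \+ (fun y : borel Y0 => a%:E * (C * mdist v0 (y : Y0))%:E))%E) => //.
- exact/measurable_EFinP.
- move=> v _; rewrite lee_fin [leRHS]ger0_norm; last first.
    by rewrite addr_ge0 ?mulr_ge0 ?mdist_ge0 ?(ltW C_gt0)//; case/andP: a01.
  have := u_lip v0 v; have := ler_normD (u v - u v0) (u v0).
  by rewrite subrK distrC; lra.
apply: integrableD => //; first exact: finite_measure_integrable_cst.
by apply: integrableZl => //; exact: dist_integrable.
Qed.

(** Centering is averaging against an independent copy of the noise, so the
    Lipschitz bound is averaged into the potential. *)
Lemma lip_noise_center (v : Y0) : `|u v - m| <= a * g v.
Proof.
have iu := lip_noise_integrable.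
have ic : nu.-integrable setT (EFin \o (cst (u v))).
  exact: finite_measure_integrable_cst.
have id : nu.-integrable setT (EFin \o (fun y : borel Y0 => u v - u y)).
  exact: integrableB ic iu.
have -> : u v - m = \int[nu]_y (u v - u y).
  rewrite RintegralB//; congr (_ - _).
  by rewrite Rintegral_cst// [X in fine X]probability_setT mulr1.
apply: (le_trans (le_normr_Rintegral _ _)) => //.
have ia : nu.-integrable setT
    (EFin \o (fun y : borel Y0 => a * (C * mdist v (y : Y0)))).
  exact: (@integrableZl _ _ _ nu setT measurableT a _ (dist_integrable v)).
have -> : a * g v = \int[nu]_y (a * (C * mdist v (y : Y0))).
  by rewrite RintegralZl//; exact: dist_integrable.
apply: le_Rintegral => //; exact: integrable_norm id.
Qed.

Lemma lip_noise_mean0 : (\int[nu]_v (u v - m)%:E = 0)%E.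
Proof.
have iu := lip_noise_integrable.
have := @integralB_EFin _ _ _ nu setT u (cst m) measurableT iu.
rewrite /= => ->; last exact: finite_measure_integrable_cst.
rewrite integral_cst// [X in (_ * X)%E]probability_setT mule1.
by rewrite /m /Rintegral fineK ?subee//; exact: integrable_fin_num.
Qed.

Let tail_moment (v : Y0) :
  (u v - m) ^+ 2 * expR (`|u v - m| `^ p) <= a ^+ 2 * (g v ^+ 2 * expR (g v `^ p)).
Proof. by apply: sqr_expR_powR_le => //; exact: lip_noise_center. Qed.

(** Integrating [expR_truncate_le]: the linear term vanishes since the function
    is centered, and the remainder is controlled by the moment [M]. *)
Lemma lip_noise_laplace (t z : R) : 0 < t -> 0 < z -> t * z `^ (1 - p) <= 1 ->
  (\int[nu]_v (expR (t * truncate z (u v - m)))%:E <=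
   (expR (t ^+ 2 / 2 * (a ^+ 2 * M)))%:E)%E.
Proof.
move=> t0 z0 tz.
have iu := lip_noise_integrable.
have iq := noise_moment_integrable sepY C_gt0 p_gt0 moment.
have iv : nu.-integrable setT (fun v : borel Y0 => (u v - m)%:E).
  have ic : nu.-integrable setT (EFin \o cst m).
    exact: finite_measure_integrable_cst.
  exact: integrableB iu ic.
pose b := t ^+ 2 / 2 * a ^+ 2.
have b0 : 0 <= b by rewrite mulr_ge0 ?sqr_ge0// divr_ge0 ?sqr_ge0.
pose f2 := fun v : borel Y0 =>
  ((1%:E + t%:E * (u v - m)%:E) + b%:E * (g v ^+ 2 * expR (g v `^ p))%:E)%E.
have i1 : nu.-integrable setT (EFin \o (cst 1)).
  exact: finite_measure_integrable_cst.
have it := @integrableZl _ _ _ nu setT measurableT t _ iv.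
have ib := @integrableZl _ _ _ nu setT measurableT b _ iq.
have i1t := integrableD measurableT i1 it.
have if2 : nu.-integrable setT f2 := integrableD measurableT i1t ib.
have mtrunc : measurable_fun setT
    (fun v : borel Y0 => expR (t * truncate z (u v - m))).
  apply: measurableT_comp => //; apply: measurable_funM => //.
  by apply: (measurableT_comp (measurable_truncate z)); exact: measurable_funB.
apply: (@le_trans _ _ (\int[nu]_v f2 v)%E).
  apply: ge0_le_integral => //=.
  - exact/measurable_EFinP.
  - exact: (measurable_int nu if2).
  - move=> v _; rewrite /f2 -!EFinM -!EFinD lee_fin.
    apply: (le_trans (expR_truncate_le _ p_gt0 p_lt1 t0 z0 tz)).
    rewrite lerD2l /b -[leRHS]mulrA ler_wpM2l ?divr_ge0 ?sqr_ge0//.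
rewrite integralD// integralD//.
rewrite !integralZl//= lip_noise_mean0 mule0 adde0.
rewrite integral_cst// [X in (_ * X)%E]probability_setT mule1.
apply: (@le_trans _ _ (1%:E + b%:E * M%:E)%E).
  rewrite leeD2l// lee_wpmul2l ?lee_fin//; exact: noise_moment.
rewrite -EFinM -EFinD lee_fin mulrA; exact: expR_ge1Dx.
Qed.

Lemma measurable_noise_gt (b z : R) : measurable [set v : borel Y0 | z < b * g v].
Proof.
have mg : measurable_fun setT (g : borel Y0 -> R).
  exact (measurable_noise sepY C_gt0 p_gt0 moment).
rewrite [X in measurable X](_ : _ = (fun v : borel Y0 => b * g v) @^-1` `]z, +oo[).
  rewrite -[X in measurable X]setTI.
  exact: (measurable_funM (@measurable_cst _ _ _ _ setT b) mg).
by apply/seteqP; split => v; rewrite /= in_itv /= andbT.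
Qed.

(** Markov's inequality for [u^2 * exp (u^p)]. *)
Lemma noise_tail (z : R) : 0 < z ->
  (nu [set v : borel Y0 | (z < a * g v)%R] <=
   (a ^+ 2 * M * (z ^- 2 * expR (- (z `^ p))))%:E)%E.
Proof.
move=> z0.
have mg : measurable_fun setT (g : borel Y0 -> R).
  exact (measurable_noise sepY C_gt0 p_gt0 moment).
pose A := [set v : borel Y0 | (z < a * g v)%R].
have mA : measurable A by exact: measurable_noise_gt.
pose b := z ^+ 2 * expR (z `^ p).
have b0 : 0 < b by rewrite mulr_gt0 ?expR_gt0// exprn_gt0.
have H : (b%:E * nu A <= (a ^+ 2 * M)%:E)%E.
  apply: (@le_trans _ _ (\int[nu]_v
      ((a ^+ 2)%:E * (g v ^+ 2 * expR (g v `^ p))%:E))%E).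
    apply: markov_bound => //.
    - by apply: emeasurable_funM => //; apply/measurable_EFinP;
        exact: measurable_sqr_expR_powR.
    - by move=> v; rewrite -EFinM lee_fin mulr_ge0 ?sqr_ge0// mulr_ge0 ?expR_ge0 ?sqr_ge0.
    - exact: ltW.
    - move=> v /= zv; rewrite -EFinM lee_fin.
      have azv : `|z| <= a * g v by rewrite gtr0_norm// ltW.
      have := sqr_expR_powR_le p_gt0 a01 azv.
      by rewrite gtr0_norm.
  rewrite [leRHS]EFinM ge0_integralZl//=.
  - by rewrite lee_wpmul2l ?lee_fin ?sqr_ge0//; exact: noise_moment.
  - by apply/measurable_EFinP; exact: measurable_sqr_expR_powR.
  - by move=> v _; rewrite lee_fin mulr_ge0 ?expR_ge0 ?sqr_ge0.
  - by rewrite lee_fin sqr_ge0.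
apply: (@le_trans _ _ ((b^-1)%:E * (a ^+ 2 * M)%:E)%E).
  by rewrite lee_pdivlMl.
by rewrite -EFinM lee_fin expRN -invfM mulrC.
Qed.

End centered_lipschitz_noise.

(** * Martingale increments along the chain *)

Definition set_coord {T : Type} (s : nat -> T) (k : nat) (v : T) : nat -> T :=
  fun i => if i == k then v else s i.

(** The weight [c] of the last state differs from the common weight [l] of the
    earlier ones: it also carries the influence of that state on the averaged
    future. *)
Definition path_lipschitz {R : realType} {X0 : completeMetricType R}
    (k : nat) (l c : R) (h : (nat -> X0) -> R) : Prop :=
  forall s s', `|h s - h s'| <=
    l * (\sum_(i < k) mdist (s i) (s' i)) + c * mdist (s k) (s' k).

(** Times are shifted so that the chain starts at [x 0] and [x k] is a function
    of the initial value and of the noises [e i] with [i < k]. The variable [Z]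
    only fixes the common law of the noises. *)
Section markov_chain.
Context {R : realType} {X0 Y0 : completeMetricType R}.
Context (sepX : separable X0) (sepY : separable Y0).
Context {d : measure_display} {Omega : measurableType d} (P : probability Omega R).
Context (xi : {RV P >-> borel X0}) (e : nat -> {RV P >-> borel Y0}).
Context (Z : {RV P >-> borel Y0}).
Local Notation nu := (distribution P Z).
Context (indep : forall k (A : set (borel X0)) (B : nat -> set (borel Y0)),
  measurable A -> (forall i, measurable (B i)) ->
  (P (xi @^-1` A `&` \bigcap_(i < k) (e i @^-1` B i)) =
   P (xi @^-1` A) * \prod_(i < k) nu (B i))%E).
Context (F : X0 * Y0 -> X0) (x : nat -> Omega -> X0).
Context (mF : measurable_fun setT (F : borel X0 * borel Y0 -> borel X0)).
Context (x0E : forall w, x 0%N w = xi w).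
Context (xSE : forall k w, x k.+1 w = F (x k w, e k w)).
Context (rho C : R) (C_gt0 : 0 < C).
Context (F_contract : forall v v' : X0,
  (\int[nu]_y (mdist (F (v, y : Y0)) (F (v', y : Y0)))%:E <= (rho * mdist v v')%:E)%E).
Context (F_lip : forall (v : X0) (y y' : Y0),
  mdist (F (v, y)) (F (v, y')) <= C * mdist y y').
Context (p : R) (p_gt0 : 0 < p) (p_lt1 : p < 1) (K1 K2 : R).
Context (moment_xi : (semi_exp_moment P p
  (fun w => G_noise 1 (distribution P xi) (xi w)) <= K1%:E)%E).
Context (moment_e : (semi_exp_moment P p
  (fun w => G_noise C nu (Z w)) <= K2%:E)%E).

Local Notation past := (past xi e).

Lemma measurable_past_init k : measurable_fun setT (xi : past k -> borel X0).
Proof.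
move=> _ A mA; rewrite setTI; apply: sub_sigma_algebra.
exists A, (fun=> setT); split => //.
by rewrite (_ : \bigcap_(i < k) _ = setT) ?setIT//; apply/seteqP; split.
Qed.

Lemma measurable_past_noise k i : (i < k)%N ->
  measurable_fun setT (e i : past k -> borel Y0).
Proof.
move=> ik _ A mA; rewrite setTI; apply: sub_sigma_algebra.
exists setT, (fun j => if j == i then A else setT); split => //.
  by move=> j; case: ifP.
apply/seteqP; split => w /=.
  by move=> Aw; split=> // j /= jk; case: eqP => // ->.
by move=> [_ /(_ i ik)] /=; rewrite eqxx.
Qed.

Lemma measurable_past_chain k i : (i <= k)%N ->
  measurable_fun setT (x i : past k -> borel X0).
Proof.
elim: i => [_|i IH ik].
  rewrite (_ : x 0%N = xi); first exact: measurable_past_init.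
  exact/funext.
rewrite (_ : x i.+1 = fun w => F (x i w, e i w)); last exact/funext.
apply: (measurableT_comp mF); apply: measurable_fun_pair.
  exact: IH (ltnW ik).
exact: measurable_past_noise.
Qed.

Lemma measurable_past_path k l c h : path_lipschitz k l c h ->
  measurable_fun setT ((fun w => h (x^~ w)) : past k -> R).
Proof.
move=> hlip.
apply: (@measurable_lipschitz _ X0 _ (past k) k.+1
  (fun i => if (i < k)%N then l else c) h (fun w i => x i w) sepX) => [s s'|i ik].
  rewrite big_ord_recr /= ltnn (le_trans (hlip s s'))// lerD2r mulr_sumr.
  by rewrite le_eqVlt; apply/orP; left; apply/eqP/eq_bigr => i _; rewrite ltn_ord.
exact: measurable_past_chain.
Qed.

Lemma measurable_past_mono k (W : Omega -> R) :
  measurable_fun setT (W : past k -> R) -> measurable_fun setT (W : past k.+1 -> R).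
Proof. move=> mW m0 A mA; apply: past_mono; exact: mW. Qed.

Lemma measurable_of_past k {d'} {T : measurableType d'} (W : Omega -> T) :
  measurable_fun setT (W : past k -> T) -> measurable_fun setT W.
Proof.
move=> mW m0 A mA; apply: (@past_sub _ _ _ _ _ _ _ _ xi e k).
exact: mW.
Qed.

Definition next_value (k : nat) (h : (nat -> X0) -> R) (s : nat -> X0) (y : Y0) : R :=
  h (set_coord s k.+1 (F (s k, y))).

Definition average_next (k : nat) (h : (nat -> X0) -> R) (s : nat -> X0) : R :=
  \int[nu]_y next_value k h s y.

(** [W] is the sum of the martingale increments of [h (x^~ w)] truncated at the
    level [z], and [B] contains the event that truncation has changed one of
    them; [V] bounds the sum of their conditional semi-exponential moments. *)
Definition truncated_deviation (t z : R) (k : nat)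
    (h : (nat -> X0) -> R) (V : R) : Prop :=
  exists (W : Omega -> R) (B : set Omega),
  [/\ measurable_fun setT (W : past k -> R), measurable B,
      P.-integrable setT (fun w => (h (x^~ w))%:E) &
      forall w, ~ B w -> h (x^~ w) - fine (\int[P]_w (h (x^~ w))%:E) = W w] /\
  ((\int[P]_w (expR (t * W w))%:E <= (expR (t ^+ 2 / 2 * V))%:E)%E /\
  (P B <= (V * (z ^- 2 * expR (- (z `^ p))))%:E)%E).

Section one_step.
Context (k : nat) (l c : R) (h : (nat -> X0) -> R).
Context (l0 : 0 <= l) (c01 : 0 <= c <= 1).
Context (hlip : path_lipschitz k.+1 l c h).

Let c0 : 0 <= c. Proof. by case/andP: c01. Qed.

Lemma next_value_lip s (y y' : Y0) :
  `|next_value k h s y - next_value k h s y'| <= c * (C * mdist y y').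
Proof.
apply: (le_trans (hlip _ _)); rewrite big1 ?mulr0 ?add0r.
  by rewrite /set_coord eqxx ler_wpM2l.
by move=> i _; rewrite /set_coord ltn_eqF// mdistxx.
Qed.

Let next_integrable s : nu.-integrable setT (EFin \o next_value k h s).
Proof.
exact (lip_noise_integrable sepY C_gt0 p_gt0 moment_e c01 (next_value_lip s)).
Qed.

(** The last state enters the average directly, with weight [l], and through the
    next state, with weight [c * rho] by contraction in mean. *)
Lemma average_next_lip : path_lipschitz k l (l + c * rho) (average_next k h).
Proof.
move=> s s'; rewrite /average_next.
have i1 := next_integrable s; have i2 := next_integrable s'.
pose a y := next_value k h s y - next_value k h s' y.
have ia : nu.-integrable setT (EFin \o (a : borel Y0 -> R)).
  exact: integrableB i1 i2.
pose D := l * \sum_(i < k.+1) mdist (s i) (s' i).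
have D0 : 0 <= D by rewrite mulr_ge0// sumr_ge0// => i _; exact: mdist_ge0.
pose del (y : Y0) := mdist (F (s k, y)) (F (s' k, y)).
have mdel : measurable_fun setT (del : borel Y0 -> R).
  apply: (measurable_mdist2 sepX); apply: (measurableT_comp mF);
    exact: measurable_fun_pair.
have aD y : `|a y| <= D + c * del y.
  apply: (le_trans (hlip _ _)); rewrite /set_coord eqxx.
  by under eq_bigr do rewrite ltn_eqF//.
rewrite -RintegralB//; apply: (le_trans (le_normr_Rintegral _ ia)) => //.
rewrite -lee_fin fineK; last exact: integrable_fin_num (integrable_norm ia).
apply: (@le_trans _ _ (\int[nu]_y (D%:E + c%:E * (del y)%:E))%E).
  apply: ge0_le_integral => //.
  - exact: measurable_int (integrable_norm ia).
  - apply/measurable_EFinP; apply: measurable_funD => //.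
    exact: measurable_funM.
  - by move=> y _; rewrite -EFinM -EFinD lee_fin; exact: aD.
rewrite ge0_integralD//=; last 2 first.
- by move=> y _; rewrite lee_fin mulr_ge0// mdist_ge0.
- by apply/measurable_EFinP; exact: measurable_funM.
rewrite integral_cst// [X in (_ * X)%E]probability_setT mule1.
rewrite ge0_integralZl//=; last 2 first.
- exact/measurable_EFinP.
- by move=> y _; rewrite lee_fin mdist_ge0.
apply: (@le_trans _ _ (D%:E + c%:E * (rho * mdist (s k) (s' k))%:E)%E).
  by rewrite leeD2l// lee_wpmul2l ?lee_fin//; exact: F_contract.
rewrite -EFinM -EFinD lee_fin /D big_ord_recr /= mulrDr mulrDl mulrA addrA.
exact: lexx.
Qed.

(* The next increment, as a function of the past and of the next noise. *)
Let psi (z : Omega * Y0) : R :=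
  next_value k h (x^~ z.1) z.2 - average_next k h (x^~ z.1).

Lemma measurable_innovation :
  measurable_fun setT (psi : past k * borel Y0 -> R).
Proof.
apply: measurable_funB; last first.
  exact: (measurableT_comp (measurable_past_path average_next_lip) measurable_fst).
rewrite /next_value.
apply: (@measurable_lipschitz _ X0 _ (past k * borel Y0)%type k.+2
  (fun i => if (i < k.+1)%N then l else c) h
  (fun z i => set_coord (x^~ z.1) k.+1 (F (x k z.1, z.2)) i) sepX) => [s s'|i ik].
  rewrite big_ord_recr /= ltnn (le_trans (hlip s s'))// lerD2r mulr_sumr.
  by rewrite le_eqVlt; apply/orP; left; apply/eqP/eq_bigr => i _; rewrite ltn_ord.
rewrite /set_coord; case: eqP => [_|/eqP ik1].
  apply: (measurableT_comp mF); apply: measurable_fun_pair => //.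
  exact: (measurableT_comp (measurable_past_chain (leqnn k)) measurable_fst).
have {ik1}ik : (i <= k)%N by rewrite -ltnS ltn_neqAle ik1.
exact: (measurableT_comp (measurable_past_chain ik) measurable_fst).
Qed.

Context (t z : R) (t_gt0 : 0 < t) (z_gt0 : 0 < z) (tz : t * z `^ (1 - p) <= 1).

(** The increment [dev] is centered given the past and dominated by the
    potential of the next noise. Integrating that noise out multiplies the
    Laplace transform by at most [expR (t ^+ 2 / 2 * (c ^+ 2 * K2))]. *)
Lemma truncated_deviation_next V : truncated_deviation t z k (average_next k h) V ->
  truncated_deviation t z k.+1 h (V + c ^+ 2 * K2).
Proof.
move=> [W [B [[mW mB iT WE] [mgfW PB]]]].
pose dev w := h (x^~ w) - average_next k h (x^~ w).
have psiE w : psi (w, e k w) = dev w.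
  rewrite /psi /next_value /dev; congr (h _ - _); apply/funext => i /=.
  by rewrite /set_coord; case: eqP => // ->; rewrite xSE.
have mdev : measurable_fun setT (dev : past k.+1 -> R).
  apply: measurable_funB; first exact: measurable_past_path hlip.
  exact: measurable_past_mono (measurable_past_path average_next_lip).
have PZ : forall A, measurable A -> P (e k @^-1` A) = nu A.
  by move=> A mA; exact: noise_law indep _ _ mA.
have eqlaw : forall f : borel Y0 -> \bar R,
    (\int[distribution P (e k)]_y f y = \int[nu]_y f y)%E.
  by move=> f; apply: eq_measure_integral => A mA _; exact: PZ.
have ig : P.-integrable setT ((EFin \o noise_potential C nu) \o e k).
  apply: integrable_distribution; apply/integrableP; split.
    apply/measurable_EFinP; exact (measurable_noise sepY C_gt0 p_gt0 moment_e).
  rewrite eqlaw.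
  by have /integrableP[] := noise_integrable sepY C_gt0 p_gt0 moment_e.
have devg w : `|dev w| <= c * noise_potential C nu (e k w).
  rewrite -psiE; exact (lip_noise_center sepY C_gt0 p_gt0 moment_e c01
    (next_value_lip (x^~ w)) (e k w)).
have idev : P.-integrable setT (EFin \o dev).
  apply: (@le_integrable _ _ _ _ _ measurableT _
    (fun w => c%:E * ((EFin \o noise_potential C nu) \o e k) w)%E).
  - by apply/measurable_EFinP; exact: measurable_of_past mdev.
  - move=> w _ /=; rewrite lee_fin [leRHS]ger0_norm ?devg// mulr_ge0//.
    exact (noise_ge0 C_gt0 p_gt0 moment_e _).
  - exact: (@integrableZl _ _ _ P setT measurableT c).
have mid_past : measurable_fun setT (id : Omega -> past k).
  by apply: measurable_of_past; exact: measurable_id.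
have dev0 : (\int[P]_w (dev w)%:E = 0)%E.
  under eq_integral do rewrite -psiE.
  apply: (@indep_mean0 _ _ _ _ _ (past k) (borel Y0) P id (e k) nu) => //.
  - by move=> A D mA mD; exact (past_indep indep mA mD).
  - exact: measurable_innovation.
  - by apply: eq_integrable idev => // w _; rewrite /= psiE.
  - move=> w; have i1 := next_integrable (x^~ w).
    have ic : nu.-integrable setT (EFin \o cst (average_next k h (x^~ w))).
      exact: finite_measure_integrable_cst.
    exact: integrableB i1 ic.
  - move=> w; exact (lip_noise_mean0 sepY C_gt0 p_gt0 moment_e c01
      (next_value_lip (x^~ w))).
have hE w : h (x^~ w) = average_next k h (x^~ w) + dev w by rewrite addrC subrK.
have ih : P.-integrable setT (fun w => (h (x^~ w))%:E).
  by apply: eq_integrable (integrableD measurableT iT idev) => // w _; rewrite hE EFinD.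
have Eh : (\int[P]_w (h (x^~ w))%:E = \int[P]_w (average_next k h (x^~ w))%:E)%E.
  under eq_integral do rewrite hE EFinD.
  by rewrite integralD// dev0 adde0.
exists (fun w => W w + truncate z (dev w)).
exists (B `|` (e k @^-1` [set y : borel Y0 | z < c * noise_potential C nu y])).
have mg : measurable [set y : borel Y0 | z < c * noise_potential C nu y].
  exact (measurable_noise_gt sepY C_gt0 p_gt0 moment_e c z).
split; [split|split].
- apply: measurable_funD; first exact: measurable_past_mono.
  exact: (measurableT_comp (measurable_truncate z)).
- by apply: measurableU => //; exact: measurable_funPTI.
- exact: ih.
- move=> w /not_orP[/WE Bw /negP]; rewrite -leNgt => zw.
  rewrite Eh -Bw /truncate (le_trans (ler_norm _) (le_trans (devg w) zw)) /dev.
  by ring.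
- rewrite mulrDr expRD EFinM.
  pose E := expR (t ^+ 2 / 2 * (c ^+ 2 * K2)).
  have mW' := measurable_of_past mW.
  have mexpW : measurable_fun setT (fun w : past k => expR (t * W w)).
    by apply: measurableT_comp => //; exact: measurable_funM.
  pose f (y : past k * borel Y0) :=
    (expR (t * W y.1) * expR (t * truncate z (psi y)))%:E.
  apply: (@le_trans _ _ (\int[P]_w ((expR (t * W w))%:E * E%:E))%E).
    rewrite (eq_integral (fun w => f (w, e k w))); last first.
      by move=> w _; rewrite /f psiE /= -expRD -mulrDr.
    apply: (@indep_fubini_le _ _ _ _ _ (past k) (borel Y0) P id (e k) nu _ _ _ f
      (fun w => (expR (t * W w))%:E * E%:E)%E) => //.
    - by move=> A D mA mD; exact (past_indep indep mA mD).
    - apply/measurable_EFinP; apply: measurable_funM.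
        exact: (measurableT_comp mexpW measurable_fst).
      apply: measurableT_comp => //; apply: measurable_funM => //.
      exact: (measurableT_comp (measurable_truncate z) measurable_innovation).
    - by move=> y; rewrite lee_fin mulr_ge0 ?expR_ge0.
    - by apply: emeasurable_funM => //; exact/measurable_EFinP.
    - move=> w; rewrite /f /=.
      under eq_integral do rewrite EFinM.
      have mpw : measurable_fun setT (fun y : borel Y0 => psi (w, y)).
        rewrite /psi /=; apply: measurable_funB; last exact: measurable_cst.
        apply/measurable_EFinP; exact: measurable_int (next_integrable (x^~ w)).
      rewrite ge0_integralZl//=.
      + rewrite lee_wpmul2l ?lee_fin ?expR_ge0//.
        exact (lip_noise_laplace sepY C_gt0 p_gt0 p_lt1 moment_e c01
          (next_value_lip (x^~ w)) t_gt0 z_gt0 tz).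
      + apply/measurable_EFinP; apply: measurableT_comp => //.
        apply: measurable_funM => //.
        exact: (measurableT_comp (measurable_truncate z) mpw).
  rewrite ge0_integralZr//=.
  - by rewrite lee_wpmul2r ?lee_fin ?expR_ge0.
  - apply/measurable_EFinP; apply: measurableT_comp => //.
    exact: measurable_funM.
  - by rewrite lee_fin expR_ge0.
- have me := measurable_funPTI (e k) mg.
  apply: (le_trans (measureU2 _ mB me)).
  rewrite mulrDl EFinD; apply: leeD => //.
  have := noise_tail sepY C_gt0 p_gt0 moment_e c01 z_gt0.
  by rewrite -PZ.
Qed.

End one_step.

(** At time zero the path functional is a Lipschitz function of the initial
    value, which plays the role of a noise with constant [1]. *)
Lemma truncated_deviation_init (l c t z : R) (h : (nat -> X0) -> R) :
  0 <= c <= 1 -> path_lipschitz 0 l c h ->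
  0 < t -> 0 < z -> t * z `^ (1 - p) <= 1 -> truncated_deviation t z 0 h (c ^+ 2 * K1).
Proof.
move=> c01 hlip t0 z0 tz.
have h0 s s' : `|h s - h s'| <= c * mdist (s 0%N) (s' 0%N).
  by have := hlip s s'; rewrite big_ord0 mulr0 add0r.
pose u (v : X0) := h (fun=> v).
have ulip v v' : `|u v - u v'| <= c * (1 * mdist v v').
  by rewrite mul1r; exact: h0.
have hu w : h (x^~ w) = u (xi w).
  apply/eqP; rewrite -subr_eq0 -normr_le0 (le_trans (h0 _ _))//= x0E.
  by rewrite mdistxx mulr0.
have iu := lip_noise_integrable sepX ltr01 p_gt0 moment_xi c01 ulip.
pose m : R := \int[distribution P xi]_v u v.
have ih : P.-integrable setT (fun w => (h (x^~ w))%:E).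
  apply: eq_integrable (integrable_distribution iu) => // w _.
  by rewrite /= hu.
have Eh : fine (\int[P]_w (h (x^~ w))%:E) = m.
  rewrite /m /Rintegral integral_distribution.
  - by congr fine; apply: eq_integral => w _; rewrite hu.
  - exact: measurable_int iu.
  - exact: integrable_distribution.
have mu : measurable_fun setT (u : borel X0 -> R).
  by apply/measurable_EFinP; exact: measurable_int iu.
have mtu : measurable_fun setT (fun v : borel X0 => truncate z (u v - m)).
  by apply: (measurableT_comp (measurable_truncate z)); exact: measurable_funB.
exists (fun w => truncate z (u (xi w) - m)).
exists (xi @^-1` [set v : borel X0 | z < c * noise_potential 1 (distribution P xi) v]).
have mg : measurable
    [set v : borel X0 | z < c * noise_potential 1 (distribution P xi) v].
  exact (measurable_noise_gt sepX ltr01 p_gt0 moment_xi c z).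
split; [split|split].
- have mx := @measurable_past_init 0%N.
  exact: (measurableT_comp mtu mx).
- exact: measurable_funPTI.
- exact: ih.
- move=> w /= /negP; rewrite -leNgt => zw; rewrite Eh hu /truncate.
  rewrite (le_trans (ler_norm _) (le_trans _ zw))//.
  exact (lip_noise_center sepX ltr01 p_gt0 moment_xi c01 ulip (xi w)).
- have := lip_noise_laplace sepX ltr01 p_gt0 p_lt1 moment_xi c01 ulip t0 z0 tz.
  apply: le_trans; rewrite le_eqVlt; apply/orP; left; apply/eqP/esym.
  rewrite ge0_integral_distribution//.
  apply/measurable_EFinP; apply: measurableT_comp => //.
  exact: measurable_funM.
- exact (noise_tail sepX ltr01 p_gt0 moment_xi c01 z0).
Qed.

(** Induction on the time horizon: averaging a functional of the states up to
    time [k.+1] gives a functional of the states up to time [k], whose last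
    weight is given by the recursion of [a]. *)
Lemma truncated_deviation_path (N : nat) (l t z : R) (a : nat -> R) :
  0 <= l -> (forall i, (i <= N)%N -> 0 <= a i <= 1) ->
  (forall i, (i < N)%N -> l + a i.+1 * rho = a i) ->
  0 < t -> 0 < z -> t * z `^ (1 - p) <= 1 ->
  forall k h, (k <= N)%N -> path_lipschitz k l (a k) h ->
  truncated_deviation t z k h (a 0%N ^+ 2 * K1 + \sum_(1 <= i < k.+1) a i ^+ 2 * K2).
Proof.
move=> l0 a01 arec t0 z0 tz; elim=> [|k IH] h kN hlip.
  rewrite big_geq// addr0; apply: truncated_deviation_init hlip _ _ _ => //.
  exact: a01.
rewrite big_nat_recr//= addrA.
apply: (truncated_deviation_next l0 (a01 _ kN) hlip t0 z0 tz).
apply: IH; first exact: ltnW.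
rewrite -arec//; exact (average_next_lip l0 (a01 _ kN) hlip).
Qed.

(** Chernoff's bound for [W] outside of [B], plus the probability of [B]. *)
Lemma truncated_deviation_tail (t z y V : R) (k : nat) (h : (nat -> X0) -> R) :
  0 < t -> truncated_deviation t z k h V ->
  measurable_fun setT (fun w => h (x^~ w)) ->
  (P [set w | (y <= h (x^~ w) - fine (\int[P]_w (h (x^~ w))%:E))%R] <=
   (expR (- (t * y) + t ^+ 2 / 2 * V) + V * (z ^- 2 * expR (- (z `^ p))))%:E)%E.
Proof.
move=> t0 [W [B [[/measurable_of_past mW mB _ WE] [mgfW PB]]]] mh.
set S := [set w | _].
have mle (u : Omega -> R) : measurable_fun setT u -> measurable [set w | y <= u w].
  move=> mu; rewrite [X in measurable X](_ : _ = u @^-1` `[y, +oo[).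
    by rewrite -[X in measurable X]setTI; exact: mu.
  by apply/seteqP; split => w; rewrite /= in_itv /= andbT.
have mS : measurable S by apply: mle; exact: measurable_funB.
have mA := mle W mW.
apply: (@le_trans _ _ (P ([set w | y <= W w] `|` B))).
  apply: le_measure; rewrite ?inE//; first exact: measurableU.
  move=> w Sw; have [Bw|Bw] := pselect (B w); [by right|left].
  by rewrite /= -WE.
apply: (le_trans (measureU2 _ mA mB)); rewrite EFinD; apply: leeD => //.
have H : ((expR (t * y))%:E * P [set w | (y <= W w)%R] <=
    \int[P]_w (expR (t * W w))%:E)%E.
  apply: markov_bound => //.
  - apply/measurable_EFinP; apply: measurableT_comp => //.
    exact: measurable_funM.
  - by move=> w yW; rewrite lee_fin ler_expR ler_pM2l.
have {}H := le_trans H mgfW.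
apply: (@le_trans _ _ ((expR (t * y))^-1%:E * (expR (t ^+ 2 / 2 * V))%:E)%E).
  by rewrite lee_pdivlMl// expR_gt0.
by rewrite -EFinM lee_fin expRD expRN.
Qed.

End markov_chain.

(** * The deviation inequality *)

Section noise_sequence.
Context {R : realType} {d d1 d2 : measure_display} {Omega : measurableType d}.
Context {TX : measurableType d1} {TY : measurableType d2}.
Context (P : probability Omega R) (xi : {RV P >-> TX}).
Context (eps : nat -> {RV P >-> TY}).
Context (eps_iid : iid [set i | (1 <= i)%N] eps).
Context (xi_indep : independent_families P
  (preimage_set_system setT xi measurable)
  (generated_sigma [set i | (2 <= i)%N] eps)).

(** The noise [eps i.+2] drives the [i]-th step of the shifted chain, and all
    laws are expressed through that of [eps 1]. *)
Lemma init_noise_independent k (A : set TX) (B : nat -> set TY) :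
  measurable A -> (forall i, measurable (B i)) ->
  (P (xi @^-1` A `&` \bigcap_(i < k) (eps i.+2 @^-1` B i)) =
   P (xi @^-1` A) * \prod_(i < k) distribution P (eps 1%N) (B i))%E.
Proof.
move=> mA mB; rewrite xi_indep.
- congr (_ * _)%E; case: eps_iid => eindep elaw.
  have -> : \bigcap_(i < k) (eps i.+2 @^-1` B i) =
      \bigcap_(j in [set` iota 2 k]) (eps j @^-1` B j.-2).
    apply/seteqP; split => w H i /=; last first.
      by move=> ik; apply: (H i.+2); rewrite /= mem_iota /= add2n !ltnS.
    by rewrite mem_iota; case: i => [|[|i]]//=; rewrite add2n !ltnS => /H.
  rewrite (eindep _ (fun j => B j.-2)) ?iota_uniq//; last first.
    by move=> i /=; rewrite mem_iota => /andP[/ltnW].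
  rewrite (iotaDl 2 0) big_map -[k in iota 0 k]subn0 big_mkord.
  apply: eq_bigr => i _; rewrite add2n /=.
  exact: (elaw i.+2 1%N).
- by exists A => //; rewrite setTI.
- pose G := \bigcup_(i in [set i | (2 <= i)%N])
    preimage_set_system setT (eps i) measurable.
  suff : measurable (\bigcap_(i < k) (eps i.+2 @^-1` B i) : set (g_sigma_algebraType G)).
    by [].
  apply: bigcap_measurableType => i _; apply: sub_sigma_algebra.
  by exists i.+2 => //; exists (B i) => //; rewrite setTI.
Qed.

End noise_sequence.

Lemma geomKS {R : realType} (k : nat) (rho : R) :
  geomK k.+1 rho = 1 + geomK k rho * rho.
Proof.
rewrite /geomK big_ord_recl expr0 mulr_suml; congr (_ + _).
by apply: eq_bigr => i _; rewrite /= exprSr.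
Qed.

Lemma geomK0 {R : realType} (rho : R) : geomK 0 rho = 1.
Proof. by rewrite /geomK big_ord1 expr0. Qed.

Lemma geomK_ge0 {R : realType} (k : nat) (rho : R) : 0 <= rho -> 0 <= geomK k rho.
Proof. by move=> r0; rewrite sumr_ge0// => i _; rewrite exprn_ge0. Qed.

Lemma geomK_le {R : realType} (k m : nat) (rho : R) : 0 <= rho -> (k <= m)%N ->
  geomK k rho <= geomK m rho.
Proof.
move=> r0; elim: m => [|m IH]; first by rewrite leqn0 => /eqP ->.
rewrite leq_eqVlt => /predU1P[->//|/IH /le_trans]; apply.
by rewrite {2}/geomK big_ord_recr /= lerDl exprn_ge0.
Qed.

Theorem proposition3p5 (R : realType)
  (X0 Y0 : completeMetricType R)
  (sepX : separable X0) (sepY : separable Y0)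
  (d : measure_display) (Omega : measurableType d) (P : probability Omega R)
  (eps : nat -> {RV P >-> borel Y0})
  (X : nat -> {RV P >-> borel X0})
  (F : X0 * Y0 -> X0)
  (rho C : R)
  (eps_iid : iid [set i | (1 <= i)%N] eps)
  (X1_indep : independent_families P
     (preimage_set_system setT (X 1%N) measurable)
     (generated_sigma [set i | (2 <= i)%N] eps))
  (mF : measurable_fun setT (F : borel X0 * borel Y0 -> borel X0))
  (X_chain : forall (k : nat) (w : Omega), (2 <= k)%N ->
     X k w = F (X k.-1 w, eps k w))
  (rho_ge0 : 0 <= rho) (rho_lt1 : rho < 1) (C_gt0 : 0 < C)
  (F_contract : forall x x' : X0,
     ('E_P[fun w => mdist (F (x, eps 1%N w)) (F (x', eps 1%N w))]
        <= (rho * mdist x x')%:E)%E)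
  (F_lip : forall (x : X0) (y y' : Y0),
     mdist (F (x, y)) (F (x, y')) <= C * mdist y y')
  (n : nat) (n_ge1 : (1 <= n)%N)
  (f : n.-tuple X0 -> R)
  (f_lip : forall s t : n.-tuple X0,
     `|f s - f t| <= \sum_(i < n) mdist (tnth s i) (tnth t i))
  (p : R) (p_gt0 : 0 < p) (p_lt1 : p < 1)
  (K1 K2 : R) (K1_gt0 : 0 < K1) (K2_gt0 : 0 < K2)
  (moment_X1 :
     (semi_exp_moment P p
        (fun w => G_init (distribution P (X 1%N)) (X 1%N w)) <= K1%:E)%E)
  (moment_eps :
     (semi_exp_moment P p
        (fun w => G_noise C (distribution P (eps 1%N)) (eps 1%N w))
        <= K2%:E)%E) :
  let S := centered P (fun w => f (path_tuple X n w)) in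
  let L := geomK n.-1 rho in
  let K := K1 + K2 * \sum_(2 <= i < n.+1) (geomK (n - i) rho / L) ^+ 2 in
  forall (s : bool) (x : R),
    (0 <= x -> x < K `^ (2 - p)^-1 ->
      (P [set w | (x <= (-1) ^+ s * S w)%R] <=
        (expR (- (x ^+ 2 / (2 * K * L ^+ 2))) +
         (if x == 0 then 0 else
         L ^+ 2 * (x ^+ 2 / K `^ (1 + p)) `^ (1 - p)^-1 *
         expR (- ((K / (x * L `^ (1 - p))) `^ (p / (1 - p))))))%:E)%E) /\
    (K `^ (2 - p)^-1 <= x ->
      (P [set w | (x <= (-1) ^+ s * S w)%R] <=
        (expR (- ((x / L) `^ p * (1 - K / 2 * (L / x) `^ (2 - p)))) +
         K * (L / x) ^+ 2 * expR (- ((x / L) `^ p)))%:E)%E).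
Proof.
move=> S L K s x.
(* The tuples have length [N.+1], so that the last state of the shifted chain
   has index [N] and [L = geomK N rho]. *)
case: n n_ge1 f f_lip @S @L @K => [//|N] _ {}f {}f_lip S L K.
have L1 : 1 <= L by rewrite -(geomK0 rho); exact: geomK_le.
have L0 : 0 < L by exact: lt_le_trans L1.
have K0 : 0 < K.
  rewrite ltr_pwDl// mulr_ge0 ?(ltW K2_gt0)// sumr_ge0// => i _.
  exact: sqr_ge0.
pose e i := eps i.+2.
pose xx i := X i.+1.
have indep := init_noise_independent eps_iid X1_indep.
have xxS k w : xx k.+1 w = F (xx k w, e k w) by rewrite /xx X_chain.
have F_contract' (v v' : X0) :
    (\int[distribution P (eps 1%N)]_y (mdist (F (v, y : Y0)) (F (v', y : Y0)))%:E
       <= (rho * mdist v v')%:E)%E.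
  apply: le_trans (F_contract v v'); rewrite unlock.
  rewrite ge0_integral_distribution//; last first.
    by move=> y; rewrite lee_fin mdist_ge0.
  apply/measurable_EFinP; apply: (measurable_mdist2 sepX);
    by apply: (measurableT_comp mF); exact: measurable_fun_pair.
have moment_X1' : (semi_exp_moment P p
    (fun w => G_noise 1 (distribution P (X 1%N)) (X 1%N w)) <= K1%:E)%E.
  rewrite (_ : (fun w => _) = (fun w => G_init (distribution P (X 1%N)) (X 1%N w)))//.
  by apply/funext => w; apply: eq_integral => y _; rewrite mul1r.
(* Scaling by [1 / L] brings all the weights [a i] below one; the sign turns
   both one-sided deviations into upper deviations. *)
pose c : R := (-1) ^+ s / L.
have cn0 : c != 0 by rewrite mulf_neq0 ?signr_eq0// invr_eq0 gt_eqF.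
have nc : `|c| = L^-1 by rewrite normrM normr_sign mul1r ger0_norm// invr_ge0 ltW.
pose h (sg : nat -> X0) := c * f [tuple sg i | i < N.+1].
have hlip : path_lipschitz N L^-1 (L^-1 * geomK (N - N) rho) h.
  move=> u v; rewrite -mulrBr normrM nc subnn geomK0 mulr1 -mulrDr.
  rewrite ler_wpM2l ?invr_ge0 ?(ltW L0)//.
  apply: (le_trans (f_lip _ _)); rewrite big_ord_recr /=.
  by under eq_bigr do rewrite !tnth_mktuple /=; rewrite !tnth_mktuple.
pose a i := L^-1 * geomK (N - i) rho.
have LV0 : 0 <= L^-1 by rewrite invr_ge0 ltW.
have a01 i : (i <= N)%N -> 0 <= a i <= 1.
  move=> iN; rewrite /a mulr_ge0 ?geomK_ge0//= mulrC ler_pdivrMr// mul1r.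
  by apply: geomK_le => //; exact: leq_subr.
have arec i : (i < N)%N -> L^-1 + a i.+1 * rho = a i.
  move=> iN; rewrite /a -mulrA -[X in X + _]mulr1 -mulrDr -geomKS.
  by rewrite subnSK.
have Khat : a 0%N ^+ 2 * K1 + \sum_(1 <= i < N.+1) a i ^+ 2 * K2 = K.
  rewrite /a subn0 mulVf ?gt_eqF// expr1n mul1r; congr (_ + _).
  rewrite [in RHS]big_add1 mulr_sumr; apply: eq_bigr => i _.
  by rewrite mulrC [L^-1 * _]mulrC subSS.
have mf : measurable_fun setT (fun w => f (path_tuple X N.+1 w)).
  apply: (@measurable_lipschitz _ X0 _ Omega N.+1 (fun=> 1)
    (fun sg => f [tuple sg i | i < N.+1]) (fun w => xx^~ w) sepX) => [u v|i _].
    apply: (le_trans (f_lip _ _)); rewrite le_eqVlt; apply/orP; left; apply/eqP.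
    by apply: eq_bigr => i _; rewrite !tnth_mktuple mul1r.
  exact: measurable_funPT.
have mh : measurable_fun setT (fun w => h (xx^~ w)) by exact: measurable_funM.
have tail (t z : R) : 0 < t -> 0 < z -> t * z `^ (1 - p) <= 1 ->
    (P [set w | (x <= (-1) ^+ s * S w)%R] <=
     (expR (- (t * (x / L)) + t ^+ 2 / 2 * K) +
      K * (z ^- 2 * expR (- (z `^ p))))%:E)%E.
  move=> t0 z0 tz.
  have mgf := truncated_deviation_path sepX sepY indep mF (fun w => erefl) xxS C_gt0
    F_contract' F_lip p_gt0 p_lt1 moment_X1' moment_eps LV0 a01 arec
    t0 z0 tz (leqnn N) hlip.
  rewrite Khat in mgf.
  have ih : P.-integrable setT (fun w => (h (xx^~ w))%:E).
    by have [W [B [[]]]] := mgf.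
  have Eh : fine (\int[P]_w (h (xx^~ w))%:E) =
      c * fine ('E_P[fun w => f (path_tuple X N.+1 w)])%E.
    rewrite unlock.
    have icV := @integrableZl _ _ _ P setT measurableT c^-1 _ ih.
    have ifp : P.-integrable setT (fun w => (f (path_tuple X N.+1 w))%:E).
      apply: eq_integrable icV => // w _.
      by rewrite -EFinM /h mulrA mulVf// mul1r.
    have := RintegralZl c measurableT ifp.
    by rewrite /Rintegral.
  have := truncated_deviation_tail (x / L) t0 mgf mh.
  apply: le_trans; rewrite le_eqVlt; apply/orP; left; apply/eqP; congr (P _).
  apply/seteqP; split => w /=;
    by rewrite Eh /h -mulrBr /c mulrAC ler_pdivrMr// divfK ?gt_eqF.
split.
- move=> x0 _; case: eqP => [->|/eqP xn0].
    (* At zero the bound equals one. *)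
    rewrite expr0n mul0r oppr0 expR0 addr0.
    have mS : measurable_fun setT (fun w => (-1) ^+ s * S w).
      by apply: measurable_funM => //; exact: measurable_funB.
    apply: probability_le1; rewrite -[X in measurable X]setTI.
    rewrite (_ : [set w | _] = (fun w => (-1) ^+ s * S w) @^-1` `[0, +oo[).
      exact: mS.
    by apply/seteqP; split => w; rewrite /= in_itv /= andbT.
  have {xn0}x0 : 0 < x by rewrite lt_neqAle eq_sym xn0.
  have [t0 z0 tz B] := small_deviation_parameters p_gt0 p_lt1 K0 L1 x0.
  by apply: (le_trans (tail _ _ t0 z0 tz)); rewrite lee_fin.
- move=> xK.
  have x0 : 0 < x by apply: lt_le_trans xK; exact: powR_gt0.
  have [t0 tz B] := large_deviation_parameters p K L0 x0.
  have y0 : 0 < x / L by rewrite divr_gt0.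
  by apply: (le_trans (tail _ _ t0 y0 tz)); rewrite B.
Qed.
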